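(* Let $\mu,\alpha,\beta$ be cylindric partitions with $\mu\subseteq\alpha$, $\mu\subseteq\beta$, and let $T\in\operatorname{SSCT}(\alpha/\mu)$, $U\in\operatorname{SSCT}(\beta/\mu)$. If $\operatorname{CRSK}(((T,U),\mu))=((P,Q),\lambda)$, then $\operatorname{CRSK}(((U,T),\mu))=((Q,P),\lambda)$.
   Context: Fix integers $n>k\ge1$. A cylindric partition is a weakly decreasing integer sequence $(\lambda_m)_{m\in\mathbb Z}$ with $\lambda_m=\lambda_{m+k}+n-k$. A point $(x,y)\in\mathbb Z^2$ is in plane row $x$ and lies in $\lambda$ if $y\le\lambda_x$. Boxes are classes of points modulo translation by multiples of $(-k,n-k)$; $\pi$ is the projection; row $x$ of the cylinder is the image of plane row $x$ (rows are indexed mod $k$), column $y$ is the image of plane column $y$. Within a row, boxes are ordered left to right by the $y$-coordinate of their representatives in a fixed plane row. $\mu\subseteq\lambda$ means $\mu_m\le\lambda_m$ for all $m$; boxes of $\lambda/\mu$ are those in $\lambda$ not in $\mu$. A (semistandard cylindric) tableau of shape $\lambda/\mu$ with entries in a totally ordered alphabet $A$ is a map $R$ from the boxes of $\lambda/\mu$ to $A$ such that entries weakly increase along plane rows (if $(x,y_1),(x,y_2)$ lie in $\lambda$ but not $\mu$ and $y_1<y_2$ then $R(\pi(x,y_1))\le R(\pi(x,y_2))$) and strictly increase down plane columns (if $(x_1,y),(x_2,y)$ lie in $\lambda$ but not $\mu$ and $x_1<x_2$ then $R(\pi(x_1,y))<R(\pi(x_2,y))$); its outer and inner shapes $\lambda,\mu$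 are part of its data. $\operatorname{SSCT}(\lambda/\mu)$ is the set of these. Full multi-insertion $\operatorname{FullMulti}(R,S)$: the input is a tableau $R$ with outer shape $\lambda$ and inner shape $\mu$, and a set $S$ of boxes not in $\mu$, no two in the same column, such that adding the boxes of $S$ to $\mu$ gives a cylindric partition. Choose an integer $r$ (the result does not depend on it). For $h=r,r+1,\dots,r+k-1$, go through the boxes of $S$ in row $h$ from left to right: if the box is in $\lambda$, remove its entry $x$ from $R$ and append the pair $(x,h+1)$ to a queue $q_0$; otherwise add the box to $\lambda$ (it stays empty). All boxes of $S$ are added to the inner shape. Then repeat the following one-step procedure while the current queue $q$ is nonempty: start a new empty queue $q'$; remove pairs $(x,s)$ from the front of $q$ one at a time; if $x$ is $\ge$ every entry currently in row $s$, put $x$ into the leftmost box of row $s$ not in the current outer shape and add that box to the outer shape; otherwise let $B$ be the box of the leftmost entry in row $s$ that is greater than $x$, let $x'$ be that entry, replace it by $x$, and append $(x',s+1)$ to $q'$; when $q$ is empty set $q:=q'$. The output is the resulting tableau; the new set $N(R,S)$ is the set of boxes in its outer shape but not in $\lambda$. $\operatorname{CRSK}(((T,U),\mu))$ for $T\in\operatorname{SSCT}(\alpha/\mu)$, $U\in\operatorname{SSCT}(\beta/\mu)$ is computed as follows: set $P:=T$ and let $Q$ be the empty tableau of shape $\alpha/\alpha$. For each letter $i$ occurring in $U$, in increasing order: let $S$ be the set of boxes containing $i$ in $U$; set $S':=N(P,S)$ and $P:=\operatorname{FullMulti}(P,S)$; put $i$ into every box of $S'$ in $Q$ and add the boxes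 of $S'$ to the outer shape of $Q$. Finally let $\lambda$ be the outer shape of $P$ and return $((P,Q),\lambda)$. (Then $P\in\operatorname{SSCT}(\lambda/\beta)$ and $Q\in\operatorname{SSCT}(\lambda/\alpha)$.) *)

(* Defs.v *)
From Stdlib Require Import ZArith.
From mathcomp Require Import all_boot all_order.

Set Implicit Arguments.
Unset Strict Implicit.
Unset Printing Implicit Defensive.

Definition cshape := Z -> Z.

Section Cyl.
Variables (n k : nat).

Definition kz : Z := Z.of_nat k.
Definition nkz : Z := (Z.of_nat n - Z.of_nat k)%Z.

Definition cylindric (l : cshape) : Prop :=
  (forall m : Z, (l (m + 1) <= l m)%Z) /\
  (forall m : Z, l m = (l (m + kz) + nkz)%Z).

Definition subshape (mu l : cshape) : Prop := forall m : Z, (mu m <= l m)%Z.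

(* Boxes: classes of points of Z^2 modulo translation by (-k, n-k).
   A box is represented by its canonical representative (r, y) with
   0 <= r < k; the class of the point (x, y) is [canon x y]. *)
Definition box := (Z * Z)%type.
Definition canon (x y : Z) : box := (x mod kz, y + (x / kz) * nkz)%Z.

Definition in_shape (l : cshape) (b : box) : bool := (b.2 <=? l b.1)%Z.

(* add the box b (canonical) to the cshape l (point-set union; this is the
   exact union whenever the union is again a partition-shaped set) *)
Definition add_box (l : cshape) (b : box) : cshape :=
  fun m => if (m mod kz =? b.1)%Z then Z.max (l m) (b.2 - (m / kz) * nkz)%Z
           else l m.

Definition row_ys (l mu : cshape) (r : Z) : seq Z :=
  map (fun i => mu r + 1 + Z.of_nat i)%Z (iota 0 (Z.to_nat (l r - mu r))).

Definition skew_boxes (l mu : cshape) : seq box :=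
  flatten (map (fun i => map (fun y => (Z.of_nat i, y)) (row_ys l mu (Z.of_nat i)))
               (iota 0 k)).

Section Tab.
Variables (d : Order.disp_t) (A : orderType d).

(* A tableau: outer cshape, inner cshape and entries indexed by canonical boxes;
   entries outside outer/inner are irrelevant (see tab_eq). *)
Record tableau := Tab { outer : cshape; inner : cshape; ent : Z -> Z -> A }.

Definition pent (R : tableau) (x y : Z) : A :=
  let b := canon x y in ent R b.1 b.2.

Definition in_skew (lam mu : cshape) (x y : Z) : Prop := (mu x < y <= lam x)%Z.

Definition is_SSCT (R : tableau) (lam mu : cshape) : Prop :=
  (forall m, outer R m = lam m) /\ (forall m, inner R m = mu m) /\
  (forall x y1 y2, in_skew lam mu x y1 -> in_skew lam mu x y2 -> (y1 < y2)%Z ->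
     (pent R x y1 <= pent R x y2)%O) /\
  (forall x1 x2 y, in_skew lam mu x1 y -> in_skew lam mu x2 y -> (x1 < x2)%Z ->
     (pent R x1 y < pent R x2 y)%O).

Definition tab_eq (R1 R2 : tableau) : Prop :=
  (forall m, outer R1 m = outer R2 m) /\ (forall m, inner R1 m = inner R2 m) /\
  (forall r y, (0 <= r < kz)%Z -> (inner R1 r < y <= outer R1 r)%Z ->
     ent R1 r y = ent R2 r y).

Definition upd (e : Z -> Z -> A) (b : box) (a : A) : Z -> Z -> A :=
  fun r y => if (r =? b.1)%Z && (y =? b.2)%Z then a else e r y.

Definition insert_pair (R : tableau) (p : A * Z) : tableau * option (A * Z) :=
  let (x, s) := p in
  let r := (s mod kz)%Z in
  let ys := row_ys (outer R) (inner R) r in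
  match [seq y <- ys | (x < ent R r y)%O] with
  | [::] =>
      let b := (r, outer R r + 1)%Z in
      (Tab (add_box (outer R) b) (inner R) (upd (ent R) b x), None)
  | y :: _ =>
      (Tab (outer R) (inner R) (upd (ent R) (r, y) x), Some (ent R r y, s + 1)%Z)
  end.

Definition round (R : tableau) (q : seq (A * Z)) : tableau * seq (A * Z) :=
  foldl (fun st p => let: (R0, q') := st in
                     let: (R1, o) := insert_pair R0 p in
                     (R1, match o with None => q' | Some p' => rcons q' p' end))
        (R, [::]) q.

Fixpoint bump_loop (fuel : nat) (R : tableau) (q : seq (A * Z)) : option tableau :=
  match q with
  | [::] => Some R
  | _ => match fuel with
         | O => None
         | S f => let: (R', q') := round R q in bump_loop f R' q'
         end
  end.

(* initial phase of FullMulti, with the choice r = 0: rows h = 0, ..., k-1,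
   boxes of S in row h from left to right. *)
Definition init_phase (R : tableau) (S : seq box) : tableau * seq (A * Z) :=
  foldl (fun st h =>
     let hz := Z.of_nat h in
     let Sh := sort (fun b1 b2 : box => (b1.2 <=? b2.2)%Z)
                    [seq b <- S | (b.1 =? hz)%Z] in
     foldl (fun st b => let: (R0, q) := st in
              if in_shape (outer R0) b
              then (R0, rcons q (ent R0 b.1 b.2, hz + 1)%Z)
              else (Tab (add_box (outer R0) b) (inner R0) (ent R0), q))
           st Sh)
   (R, [::]) (iota 0 k).

Definition full_multi (fuel : nat) (R : tableau) (S : seq box) : option tableau :=
  let: (R0, q0) := init_phase R S in
  let R1 := Tab (outer R0) (foldl add_box (inner R0) S) (ent R0) in
  bump_loop fuel R1 q0.

Definition letters (U : tableau) : seq A :=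
  sort (fun a b : A => (a <= b)%O)
       (undup [seq ent U b.1 b.2 | b <- skew_boxes (outer U) (inner U)]).

Definition boxes_with (U : tableau) (i : A) : seq box :=
  [seq b <- skew_boxes (outer U) (inner U) | ent U b.1 b.2 == i].

Definition crsk_step (fuel : nat) (U : tableau) (st : option (tableau * tableau)) (i : A)
  : option (tableau * tableau) :=
  match st with
  | None => None
  | Some (P, Q) =>
    match full_multi fuel P (boxes_with U i) with
    | None => None
    | Some P' =>
      Some (P', Tab (outer P') (inner Q)
                  (fun r y => if in_shape (outer P') (r, y) && ~~ in_shape (outer P) (r, y)
                              then i else ent Q r y))
    end
  end.

(* CRSK(((T,U),mu)) with fuel bound; Q starts as the empty tableau of cshape alpha/alpha
   (its entry function is irrelevant and is taken from T). *)
Definition crsk_run (fuel : nat) (T U : tableau) : option (tableau * tableau * cshape) :=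
  match foldl (crsk_step fuel U) (Some (T, Tab (outer T) (outer T) (ent T))) (letters U) with
  | None => None
  | Some (P, Q) => Some (P, Q, outer P)
  end.

Definition CRSK_is (T U P Q : tableau) (lam : cshape) : Prop :=
  exists fuel P' Q' lam', crsk_run fuel T U = Some (P', Q', lam') /\
    tab_eq P P' /\ tab_eq Q Q' /\ (forall m, lam m = lam' m).

End Tab.
End Cyl.

(* Main.v *)
Require Import Defs.
From Stdlib Require Import ZArith.
From mathcomp Require Import all_boot all_order.
From mathcomp Require Import ssrZ zify.
Import Order.TTheory.

Set Implicit Arguments.
Unset Strict Implicit.
Unset Printing Implicit Defensive.

(** A row-weak tableau with letters a_0 < a_1 < ... is the same as the chain of shapes
C_0 <= C_1 <= ... in which a_i fills the boxes between C_i and C_(i+1). Inserting a strip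
b / C_0 replaces this chain by D_0 = b, D_1, D_2, ... given by the local rule
  D_(i+1)(x) = max(C_(i+1), D_i)(x) + min(C_(i+1), D_i)(x - 1) - C_i(x - 1),
because an a_i leaves row x - 1 exactly when its box is reached by D_i, and every
letter leaving row x - 1 ends up in row x. The rule is symmetric in C_(i+1) and D_i, so the
growth diagram of CRSK is transposed when T and U are exchanged. Along the run of the
insertion queue the rule holds up to the letters still waiting in the queue; this also
bounds the shapes, hence the number of steps. *)

(** * Integer intervals as lists *)

Definition zrange (lo hi : Z) : seq Z :=
  [seq (lo + 1 + Z.of_nat i)%Z | i <- iota 0 (Z.to_nat (hi - lo))].

Lemma row_ysE l mu r : row_ys l mu r = zrange (mu r) (l r).
Proof. by []. Qed.

Lemma zrange_nil lo hi : (hi <= lo)%Z -> zrange lo hi = [::].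
Proof. by move=> h; rewrite /zrange (_ : Z.to_nat _ = 0%N) //; lia. Qed.

Lemma zrange_cat mid lo hi : (lo <= mid <= hi)%Z ->
  zrange lo hi = zrange lo mid ++ zrange mid hi.
Proof.
move=> h; rewrite /zrange.
have -> : Z.to_nat (hi - lo) = (Z.to_nat (mid - lo) + Z.to_nat (hi - mid))%N by lia.
rewrite iotaD map_cat; congr cat.
rewrite -[X in iota X _]addn0 iotaDl -map_comp; apply: eq_map => i /=; lia.
Qed.

Lemma zrange1 lo : zrange lo (lo + 1) = [:: (lo + 1)%Z].
Proof.
rewrite /zrange (_ : Z.to_nat _ = 1%N) /=; last lia.
by congr cons; lia.
Qed.

Lemma mem_zrange lo hi y : (y \in zrange lo hi) <-> (lo < y <= hi)%Z.
Proof.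
split.
  by case/mapP=> i; rewrite mem_iota => h ->; lia.
move=> h; apply/mapP; exists (Z.to_nat (y - lo - 1)); last lia.
rewrite mem_iota; lia.
Qed.

Lemma zrange_ind (lo : Z) (P : Z -> Prop) :
  P lo -> (forall hi, (lo <= hi)%Z -> P hi -> P (hi + 1)%Z) ->
  forall hi, (lo <= hi)%Z -> P hi.
Proof.
move=> P0 PS hi h.
have -> : hi = (lo + Z.of_nat (Z.to_nat (hi - lo)))%Z by lia.
elim: (Z.to_nat _) => [|m IH]; first by rewrite Z.add_0_r.
have -> : (lo + Z.of_nat m.+1 = lo + Z.of_nat m + 1)%Z by lia.
by apply: PS IH; lia.
Qed.

Lemma zrange_rcons lo hi : (lo <= hi)%Z ->
  zrange lo (hi + 1) = rcons (zrange lo hi) (hi + 1)%Z.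
Proof. by move=> h; rewrite (zrange_cat (mid := hi)) ?zrange1 ?cats1 //; lia. Qed.

Lemma sorted_zrange lo hi : sorted (fun y1 y2 => (y1 <=? y2)%Z) (zrange lo hi).
Proof.
rewrite /zrange sorted_map.
apply: sub_sorted (iota_ltn_sorted 0 _) => i j /= h; lia.
Qed.

(** A predicate closed to the left holds on an initial segment, so counting it gives the right end.
    This turns a weakly increasing row into the end points of its letters. *)
Lemma filter_zrange_initial (p : pred Z) lo hi : (lo <= hi)%Z ->
  (forall y1 y2, (lo < y1)%Z -> (y1 < y2)%Z -> (y2 <= hi)%Z -> p y2 -> p y1) ->
  forall y, (lo < y <= hi)%Z ->
    p y = (y <=? lo + Z.of_nat (count p (zrange lo hi)))%Z.
Proof.
move=> h; elim/zrange_ind: h; first by lia.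
move=> {}hi hlo IH hp y hy.
have IH' : forall y, (lo < y <= hi)%Z ->
    p y = (y <=? lo + Z.of_nat (count p (zrange lo hi)))%Z.
  by apply: IH => y1 y2 ? ? ?; apply: hp; lia.
have cle : (Z.of_nat (count p (zrange lo hi)) <= hi - lo)%Z.
  have := count_size p (zrange lo hi); rewrite size_map size_iota; lia.
rewrite zrange_rcons // -cats1 count_cat /= addn0.
case hh : (p (hi + 1)%Z); last first.
  rewrite addn0; case: (Z.eq_dec y (hi + 1)) => [->|ne]; first by lia.
  by apply: IH'; lia.
have pall : forall z, (lo < z <= hi + 1)%Z -> p z.
  move=> z hz; case: (Z.eq_dec z (hi + 1)) => [->//|ne].
  by apply: (hp z (hi + 1)%Z) => //; lia.
have -> : count p (zrange lo hi) = size (zrange lo hi).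
  apply/eqP; rewrite -all_count; apply/allP => z /mem_zrange hz; apply: pall; lia.
rewrite pall // size_map size_iota; lia.
Qed.

(** Both [skew_boxes] and the initial queue are concatenated row by row; this isolates one of their
    rows. *)
Lemma filter_flatten_iota (S : Type) (P : pred S) (F : nat -> seq S) (h m : nat) :
  (h < m)%N -> (forall i, (i < m)%N -> i <> h -> all (predC P) (F i)) ->
  all P (F h) ->
  filter P (flatten [seq F i | i <- iota 0 m]) = F h.
Proof.
move=> hm hne hP.
have none : forall a b, (forall i, (a <= i < a + b)%N -> (i < m)%N /\ i <> h) ->
    filter P (flatten [seq F i | i <- iota a b]) = [::].
  move=> a b; elim: b a => [//|b IH] a hab /=.
  rewrite filter_cat IH => [|i hi]; last by apply: hab; lia.
  have [am ah] : (a < m)%N /\ a <> h by apply: hab; lia.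
  rewrite cats0; apply/nilP; rewrite /nilp size_filter -leqn0 leqNgt -has_count.
  by move: (hne _ am ah); rewrite all_predC.
have -> : m = (h + (1 + (m - h.+1)))%N by lia.
rewrite iotaD map_cat flatten_cat filter_cat none; last by move=> i; lia.
rewrite add1n /= add0n filter_cat none; last by move=> i; lia.
by rewrite cats0; apply/all_filterP.
Qed.

(** * Rows as increasing sequences of end points *)

Definition levels (M : nat) (c : nat -> Z) : Prop :=
  forall i, (i < M)%N -> (c i <= c i.+1)%Z.

Lemma levels_le M c i j : levels M c -> (i <= j)%N -> (j <= M)%N -> (c i <= c j)%Z.
Proof.
move=> hc; elim: j => [|j IH]; first by case: i => // _ _; lia.
rewrite leq_eqVlt => /orP[/eqP->|]; first by lia.
move=> hij hj; have := hc j hj; have := IH hij (ltnW hj); lia.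
Qed.

Lemma level_between M c i j y : levels M c -> (i <= j)%N -> (j <= M)%N ->
  (c i < y <= c j)%Z -> exists2 m, (i <= m < j)%N & (c m < y <= c m.+1)%Z.
Proof.
move=> hc; elim: j => [|j IH] hij hj hy; first by move: hij hy; case: i => // _; lia.
case: (Z.ltb_spec (c j) y) => hcy.
  exists j; last lia.
  case: (ltngtP i j.+1) hij => [hij' _|//|eij _]; first by rewrite ltnSn andbT.
  by move: hy; rewrite eij; lia.
have [|m] := IH _ (ltnW hj) (conj (proj1 hy) hcy).
  case: (ltngtP i j.+1) hij => [//|//|eij _].
  by move: hy; rewrite eij; lia.
by move=> hm ?; exists m => //; lia.
Qed.

Section Levels.
Variables (d : Order.disp_t) (A : orderType d) (x0 : A) (s : seq A).
Hypothesis ss : sorted <%O s.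
Variable M : nat.
Hypothesis Ms : (M <= size s)%N.

Definition row_entries (e : Z -> A) (c : nat -> Z) : Prop :=
  forall i y, (i < M)%N -> (c i < y <= c i.+1)%Z -> e y = nth x0 s i.

Lemma nth_lt i j : (i < M)%N -> (j < M)%N -> (nth x0 s i < nth x0 s j)%O = (i < j)%N.
Proof. by move=> hi hj; apply: lt_sorted_ltn_nth => //; rewrite inE; apply: leq_trans Ms. Qed.

Lemma nth_eq i j : (i < M)%N -> (j < M)%N -> (nth x0 s i == nth x0 s j) = (i == j).
Proof. by move=> hi hj; apply: nth_uniq; rewrite ?lt_sorted_uniq //; apply: leq_trans Ms. Qed.

(** [insert_pair] matches on this list. As an interval its head is the box [c j.+1 + 1], and it is
    empty when the letter belongs at the end of the row. *)
Lemma filter_zrange_gt e c j : levels M c -> row_entries e c -> (j < M)%N ->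
  [seq y <- zrange (c 0%N) (c M) | (nth x0 s j < e y)%O] = zrange (c j.+1) (c M).
Proof.
move=> hc he hj.
have h1 : (c 0%N <= c j.+1)%Z by apply: (levels_le hc).
have h2 : (c j.+1 <= c M)%Z by apply: (levels_le hc).
rewrite (zrange_cat (mid := c j.+1)) // filter_cat.
rewrite (@eq_in_filter _ _ pred0 (zrange (c 0%N) _)) ?filter_pred0; last first.
  move=> y /mem_zrange hy; have [//|//|m hm hmy] := level_between hc _ _ hy.
  rewrite (he m) //; last lia.
  by rewrite nth_lt //=; lia.
rewrite (@eq_in_filter _ _ predT) ?filter_predT //.
move=> y /mem_zrange hy; have [//|//|m hm hmy] := level_between hc _ _ hy.
rewrite (he m) //; last lia.
by rewrite nth_lt //=; lia.
Qed.

(** Its length counts the copies of a letter in the initial queue; the interval itself is the strip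
    of one letter of the second tableau in a row. *)
Lemma filter_zrange_eq e c j : levels M c -> row_entries e c -> (j < M)%N ->
  [seq y <- zrange (c 0%N) (c M) | e y == nth x0 s j] = zrange (c j) (c j.+1).
Proof.
move=> hc he hj.
have h1 : (c 0%N <= c j)%Z by apply: (levels_le hc); lia.
have h2 : (c j.+1 <= c M)%Z by apply: (levels_le hc).
have h3 := hc j hj.
rewrite (zrange_cat (mid := c j)); last lia.
rewrite (zrange_cat (lo := c j) (mid := c j.+1)); last lia.
rewrite !filter_cat.
rewrite (@eq_in_filter _ _ pred0 (zrange (c 0%N) _)) ?filter_pred0; last first.
  move=> y /mem_zrange hy; have [||m hm hmy] := level_between hc _ _ hy; try lia.
  rewrite (he m) //; last lia.
  by rewrite nth_eq //=; lia.
rewrite (@eq_in_filter _ _ pred0 (zrange (c j.+1) _)) ?filter_pred0; last first.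
  move=> y /mem_zrange hy; have [||m hm hmy] := level_between hc _ _ hy; try lia.
  rewrite (he m) //; last lia.
  by rewrite nth_eq //=; lia.
rewrite (@eq_in_filter _ _ predT) ?filter_predT ?cats0 //.
by move=> y /mem_zrange hy; rewrite (he j) ?eqxx.
Qed.

End Levels.

(** * The local rule and the symmetric growth diagram *)

(* The symmetric local rule: it sends the shapes (C i', C i, grow i') around one
   cell of the growth diagram to the fourth corner. *)
Fixpoint grow (C : nat -> cshape) (b : cshape) (i : nat) : cshape :=
  if i is i'.+1 then
    fun x => (Z.max (C i'.+1 x) (grow C b i' x)
              + Z.min (C i'.+1 (x - 1)) (grow C b i' (x - 1)) - C i' (x - 1))%Z
  else b.

(** The growth diagram with sides [Ac], the chain of [T], and [Bc], the chain of [U]. For fixed [j]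
    it is the chain of [P] after [j] letters of [U]; the last shapes, as [j] varies, form the chain
    of [Q]. *)
Fixpoint grid (Ac Bc : nat -> cshape) (j : nat) : nat -> cshape :=
  if j is j'.+1 then grow (grid Ac Bc j') (Bc j) else Ac.

Lemma grid0 Ac Bc j x : (forall x, Ac 0%N x = Bc 0%N x) -> grid Ac Bc j 0 x = Bc j x.
Proof. by case: j. Qed.

(** Exchanging the chains exchanges two corners of a cell that enter the rule only through a maximum
    and a minimum; the sides agree because both chains start at the same shape. *)
Lemma grid_sym Ac Bc : (forall x, Ac 0%N x = Bc 0%N x) ->
  forall i j x, grid Ac Bc j i x = grid Bc Ac i j x.
Proof.
move=> e; elim=> [|i IHi] j; first by move=> x; rewrite grid0.
elim: j => [//|j IHj] x.
have E : forall Ac Bc i j x, grid Ac Bc j.+1 i.+1 x =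
    (Z.max (grid Ac Bc j i.+1 x) (grid Ac Bc j.+1 i x)
     + Z.min (grid Ac Bc j i.+1 (x - 1)) (grid Ac Bc j.+1 i (x - 1)) - grid Ac Bc j i (x - 1))%Z.
  by [].
by rewrite !E !IHj !IHi; lia.
Qed.

(** * Periodicity, strips and the addition of boxes on the cylinder *)

Section Rows.
Variables (n k : nat).
Hypothesis k_gt0 : (0 < k)%N.

Definition periodic (l : cshape) : Prop := forall m, l m = (l (m + kz k) + nkz n k)%Z.

Lemma kz_gt0 : (0 < kz k)%Z.
Proof. by rewrite /kz; lia. Qed.

Lemma periodic_mul l (q m : Z) : periodic l -> l (m + q * kz k)%Z = (l m - q * nkz n k)%Z.
Proof.
move=> hl.
have pos : forall (j : nat) m', l (m' + Z.of_nat j * kz k)%Z = (l m' - Z.of_nat j * nkz n k)%Z.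
  elim=> [|j IH] m'; first by rewrite !Z.mul_0_l Z.add_0_r Z.sub_0_r.
  have -> : (m' + Z.of_nat j.+1 * kz k = (m' + kz k) + Z.of_nat j * kz k)%Z by lia.
  rewrite IH (hl m'); lia.
case: (Z.le_ge_cases 0 q) => hq.
  by have -> : q = Z.of_nat (Z.to_nat q) by lia.
have := pos (Z.to_nat (- q)) (m + q * kz k)%Z.
have -> : Z.of_nat (Z.to_nat (- q)) = (- q)%Z by lia.
have -> : (m + q * kz k + - q * kz k = m)%Z by lia.
lia.
Qed.

Lemma periodic_mod l x : periodic l ->
  l x = (l (x mod kz k) - (x / kz k) * nkz n k)%Z.
Proof.
move=> hl; rewrite -periodic_mul //; congr l.
by rewrite {1}(Z_div_mod_eq_full x (kz k)); lia.
Qed.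

Lemma mod_range x : (0 <= x mod kz k < kz k)%Z.
Proof. exact: Z.mod_pos_bound kz_gt0. Qed.

Lemma mod_succ x t :
  ((x - 1) mod kz k =? t mod kz k)%Z = (x mod kz k =? (t + 1) mod kz k)%Z.
Proof.
apply/Z.eqb_spec/Z.eqb_spec => h.
  have -> : x = (x - 1 + 1)%Z by lia.
  by rewrite Zplus_mod h -Zplus_mod.
have -> : t = (t + 1 - 1)%Z by lia.
by rewrite Zminus_mod h -Zminus_mod.
Qed.

(** Given by sorted rows because [init_phase] reads [S] that way; this also makes every box occur
    only once. *)
Definition is_strip (S : seq box) (l b : cshape) : Prop :=
  (forall p, p \in S -> (0 <= p.1 < kz k)%Z) /\
  forall h, (h < k)%N ->
    sort (fun b1 b2 : box => (b1.2 <=? b2.2)%Z) [seq p <- S | (p.1 =? Z.of_nat h)%Z] =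
    [seq (Z.of_nat h, y) | y <- zrange (l (Z.of_nat h)) (b (Z.of_nat h))].

Lemma mem_strip S l b r y : is_strip S l b ->
  (r, y) \in S <-> (0 <= r < kz k)%Z /\ (l r < y <= b r)%Z.
Proof.
move=> [Sr Srow].
have mem : (0 <= r < kz k)%Z -> (r, y) \in S <-> (l r < y <= b r)%Z.
  move=> hr; have e : r = Z.of_nat (Z.to_nat r) by lia.
  have rk : (Z.to_nat r < k)%N by move: hr; rewrite /kz; lia.
  have := Srow _ rk; rewrite -e => /(congr1 (fun s => (r, y) \in s)).
  rewrite mem_sort mem_filter /= Z.eqb_refl /= => ->.
  rewrite mem_map; first exact: mem_zrange.
  by move=> y1 y2 [].
split; last by move=> [hr hy]; apply/mem.
by move=> h; have hr := Sr _ h; split=> //; apply/mem.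
Qed.

Lemma foldl_add_box_ge S l x : (l x <= foldl (add_box n k) l S x)%Z.
Proof.
elim: S l => [|p S IH] l /=; first lia.
by have := IH (add_box n k l p); rewrite {1}/add_box; case: ifP => _; lia.
Qed.

Lemma foldl_add_box_mem S l p x : p \in S -> (x mod kz k = p.1)%Z ->
  (p.2 - (x / kz k) * nkz n k <= foldl (add_box n k) l S x)%Z.
Proof.
elim: S l => [//|p' S IH] l; rewrite inE => /orP[/eqP<-|pS] hx /=; last exact: IH.
have := @foldl_add_box_ge S (add_box n k l p) x.
by rewrite {1}/add_box hx Z.eqb_refl; lia.
Qed.

Lemma foldl_add_box_le S l b x : periodic b -> (l x <= b x)%Z ->
  (forall p, p \in S -> (p.2 <= b p.1)%Z) -> (foldl (add_box n k) l S x <= b x)%Z.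
Proof.
move=> hb; elim: S l => [//|p S IH] l hl hS /=.
apply: IH => [|p' hp']; last by apply: hS; rewrite inE hp' orbT.
rewrite /add_box; case: Z.eqb_spec => // hx.
have := hS p (mem_head _ _); rewrite (periodic_mod x hb) hx in hl *; lia.
Qed.

(** No added box leaves [b], which bounds the union from above; the last box of the strip in the row
    of [x], if there is one, attains [b]. *)
Lemma strip_union S l l' b x : periodic l -> periodic b -> is_strip S l b ->
  (forall x, (l x <= b x)%Z) -> l' x = l x -> foldl (add_box n k) l' S x = b x.
Proof.
move=> hl hb hS lb e.
have h1 : (foldl (add_box n k) l' S x <= b x)%Z.
  apply: foldl_add_box_le => //; first by have := lb x; lia.
  by move=> [r y] /(mem_strip _ _ hS) /= [_]; lia.
have h2 := @foldl_add_box_ge S l' x.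
case: (Z.ltb_spec (l x) (b x)) => hlt; last by have := lb x; lia.
have hin : ((x mod kz k)%Z, b (x mod kz k)%Z) \in S.
  apply/(mem_strip _ _ hS); split; first exact: mod_range.
  by rewrite (periodic_mod x hl) (periodic_mod x hb) in hlt; lia.
have := @foldl_add_box_mem S l' _ x hin erefl; rewrite /= -(periodic_mod x hb); lia.
Qed.

(** The tableau [R] read as a chain of shapes. Entries are stored in canonical rows only, while the
    shapes are compared on all rows. *)
Definition chain_tab (d : Order.disp_t) (A : orderType d) (x0 : A) (s : seq A) (M : nat)
    (D : nat -> cshape) (R : tableau A) : Prop :=
  [/\ forall m, inner R m = D 0%N m,
      forall m, outer R m = D M m &
      forall r, (0 <= r < kz k)%Z -> row_entries x0 s M (ent R r) (D^~ r)].

(** * The invariant of the insertion queue *)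

Section Queue.
Variables (d : Order.disp_t) (A : orderType d) (x0 : A) (s : seq A).
Hypothesis ss : sorted <%O s.
Variable M : nat.
Hypothesis Ms : (M <= size s)%N.

Definition same_row (x y : Z) : bool := (x mod kz k =? y mod kz k)%Z.

Definition pending (x : Z) (q : seq (A * Z)) : seq A :=
  [seq p.1 | p <- q & same_row p.2 x].

(* Inserting the letter [j] at the cost of the letter [m], or at the end of the row
   when [m = M]. *)
Definition raise (D : nat -> cshape) (t : Z) (j m : nat) : nat -> cshape :=
  fun i x => if same_row x t && (j < i <= m)%N then (D i x + 1)%Z else D i x.

Variable C : nat -> cshape.
Hypothesis C_levels : forall x, levels M (C^~ x).

(* [C] is the chain of the tableau before insertion and [D] its current chain, so an entry
   [i] leaves row [x - 1] when [D i] passes it; [qi_late] says that no letter larger than a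
   waiting one has been inserted into its row yet, so only original entries are bumped. *)
Record queue_inv (D : nat -> cshape) (q : seq (A * Z)) : Prop := QueueInv {
  qi_periodic : forall i, (i <= M)%N -> periodic (D i);
  qi_levels : forall x, levels M (D^~ x);
  qi_ge : forall i x, (i <= M)%N -> (C i x <= D i x)%Z;
  qi_balance : forall i x, (i < M)%N ->
    D i.+1 x = (Z.max (C i.+1 x) (D i x) + Z.min (C i.+1 (x - 1)) (D i (x - 1)) - C i (x - 1)
                - Z.of_nat (count_mem (nth x0 s i) (pending x q)))%Z;
  qi_late : forall i x a, (i < M)%N -> a \in pending x q -> (a < nth x0 s i)%O ->
    D i.+1 x = Z.max (C i.+1 x) (D i x);
  qi_sorted : forall x, pairwise <=%O (pending x q);
  qi_letters : forall x a, a \in pending x q -> exists2 j, (j < M)%N & a = nth x0 s j }.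

Arguments qi_levels {D q} _ x [i] _.
Arguments qi_periodic {D q} _ [i] _ m.
Arguments qi_ge {D q} _ [i] x _.
Arguments qi_balance {D q} _ [i] x _.

Lemma same_row_sym x y : same_row x y = same_row y x.
Proof. exact: Z.eqb_sym. Qed.

Lemma pending_cons x p q :
  pending x (p :: q) = if same_row p.2 x then p.1 :: pending x q else pending x q.
Proof. by rewrite /pending /=; case: ifP. Qed.

Lemma pending_cat x q1 q2 : pending x (q1 ++ q2) = pending x q1 ++ pending x q2.
Proof. by rewrite /pending filter_cat map_cat. Qed.

(** A list, so that it can be appended to the queue; it is empty when the letter settles at the end
    of the row, the case [m = M]. *)
Definition bumped (m : nat) (t : Z) : seq (A * Z) :=
  if (m < M)%N then [:: (nth x0 s m, t + 1)%Z] else [::].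

Lemma pending_bumped x m t :
  pending x (bumped m t) =
  if (m < M)%N && same_row (x - 1) t then [:: nth x0 s m] else [::].
Proof.
rewrite /bumped; case: ifP => //= hm.
by rewrite pending_cons /= {2}/same_row mod_succ same_row_sym.
Qed.

(** The hypotheses say that [m] is the first letter after [j] present in the row, or [M]. Levels
    [j.+1] to [m] coincide there and move right by one box; the waiting letter [j] is traded for [m]
    in the next row, and both sides of the balance change equally. *)
Lemma queue_inv_step D j t q m :
  queue_inv D ((nth x0 s j, t) :: q) -> (j < m)%N -> (m <= M)%N ->
  (forall x, same_row x t -> D m x = D j.+1 x) ->
  (forall x, same_row x t -> (m < M)%N -> (D m x < D m.+1 x)%Z) ->
  queue_inv (raise D t j m) (q ++ bumped m t).
Proof.
move=> I jm mM Dm Dm1.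
have jM : (j < M)%N by apply: leq_trans mM.
have pj x : same_row x t -> pending x ((nth x0 s j, t) :: q) = nth x0 s j :: pending x q.
  by rewrite pending_cons /= same_row_sym => ->.
have pnj x : same_row x t = false -> pending x ((nth x0 s j, t) :: q) = pending x q.
  by rewrite pending_cons /= same_row_sym => ->.
have flat x i : same_row x t -> (j < i <= m)%N -> D i x = D m x.
  move=> hx hi; have := Dm x hx.
  have [h1 h2] : (j.+1 <= i)%N /\ (i <= m)%N by lia.
  have := levels_le (qi_levels I x) h1 (leq_trans h2 mM).
  have := levels_le (qi_levels I x) h2 mM; lia.
have late x i : same_row x t -> (j < i < M)%N -> D i.+1 x = Z.max (C i.+1 x) (D i x).
  move=> hx /andP[ji iM]; apply: (@qi_late _ _ I i x (nth x0 s j)) => //.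
    by rewrite pj // mem_head.
  by rewrite (nth_lt x0 ss Ms).
(* Above [m] the row keeps its original end points: the first jump after [D m] can only come from
   [C]. *)
have Cup x i : same_row x t -> (m < i <= M)%N -> D i x = C i x.
  move=> hx; elim: i => [//|i IH] hi.
  rewrite late //; last lia.
  case: (ltnP m i) => hmi.
    by rewrite IH; [have := @C_levels x i; lia | lia].
  have -> : i = m by lia.
  have mM' : (m < M)%N by lia.
  by have := Dm1 x hx mM'; rewrite late; lia.
(* By [Cup], letters larger than [m] have no outflow into the next row. Since [D i.+1] is at least
   [C i.+1] and [D i], the balance leaves none of them waiting there. *)
have fresh x i : same_row (x - 1) t -> (m < i < M)%N ->
    D i.+1 x = Z.max (C i.+1 x) (D i x) /\
    count_mem (nth x0 s i) (pending x ((nth x0 s j, t) :: q)) = 0%N.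
  move=> hx hi; have iM : (i < M)%N by lia.
  have := qi_balance I x iM; rewrite (Cup (x - 1)%Z i hx); last lia.
  have := @C_levels (x - 1)%Z i iM; have := qi_levels I x iM.
  have := qi_ge I x iM; rewrite /=; lia.
have sub x a : a \in pending x q -> a \in pending x ((nth x0 s j, t) :: q).
  by rewrite pending_cons /=; case: ifP => // _ h; rewrite inE h orbT.
split.
- move=> i iM x; have := qi_periodic I iM x; rewrite /raise /same_row.
  have -> : ((x + kz k) mod kz k = x mod kz k)%Z.
    by rewrite -{1}(Z.mul_1_l (kz k)) Z_mod_plus_full.
  by case: ifP => _; lia.
- move=> x i iM; have := qi_levels I x iM; rewrite /raise /=.
  case hx: (same_row x t) => //=.
  case h1: (j < i <= m)%N; case h2: (j < i.+1 <= m)%N; try lia.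
  have e : i = m by lia.
  by subst i; have := Dm1 x hx iM; lia.
- by move=> i x iM; have := qi_ge I x iM; rewrite /raise; case: ifP => _; lia.
- move=> i x iM.
  have B := qi_balance I x iM.
  have Lx := qi_levels I x iM; have Gx := qi_ge I x iM.
  rewrite /= in Lx.
  rewrite pending_cat count_cat pending_bumped.
  have -> : count_mem (nth x0 s i) (if (m < M)%N && same_row (x - 1) t then [:: nth x0 s m] else [::])
       = ((m == i) && same_row (x - 1) t : nat).
    case: ifP => /=; first by case/andP=> hm ->; rewrite addn0 andbT (nth_eq x0 ss Ms).
    by case: eqP => //= [->]; rewrite iM => /= ->.
  (* The inserted letter leaves the queue and the bumped one joins it. *)
  have -> : Z.of_nat (count_mem (nth x0 s i) (pending x q) + ((m == i) && same_row (x - 1) t))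
    = (Z.of_nat (count_mem (nth x0 s i) (pending x ((nth x0 s j, t) :: q)))
       - Z.of_nat ((j == i) && same_row x t) + Z.of_nat ((m == i) && same_row (x - 1) t))%Z.
    case hx: (same_row x t).
      by rewrite pj //= (nth_eq x0 ss Ms) // andbT; lia.
    by rewrite pnj // andbF; lia.
  (* Only [m] loses a box: for [j < i < m] flatness gives [D i = D i.+1 >= C i.+1], so the minimum
     is already [C i.+1]. *)
  have -> : Z.min (C i.+1 (x - 1)%Z) (raise D t j m i (x - 1)%Z) =
     (Z.min (C i.+1 (x - 1)%Z) (D i (x - 1)%Z) + Z.of_nat ((m == i) && same_row (x - 1) t))%Z.
    rewrite /raise; case hx: (same_row (x - 1) t) => /=; last by rewrite andbF; lia.
    case: ifP => hi; last by case: eqP => /= e; lia.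
    case: eqP => /= e.
      subst i; have := Dm1 _ hx iM; rewrite late //; lia.
    have := qi_ge I (x - 1)%Z iM; rewrite (@flat (x-1)%Z i.+1) ?(@flat (x-1)%Z i) //; lia.
  (* The maximum follows the shift except at [i = j], where level [j.+1] moves and level [j] does
     not. At [i = m] it is [C m.+1] before and after. *)
  have : raise D t j m i.+1 x = (Z.max (C i.+1 x) (raise D t j m i x) + (D i.+1 x - Z.max (C i.+1 x) (D i x))
     + Z.of_nat ((j == i) && same_row x t))%Z; last lia.
  rewrite /raise; case hx: (same_row x t) => /=; last by rewrite andbF; lia.
  case: eqP => [<-|ji]; case: ifP => h1; case: ifP => h2; try lia.
    by have := @flat x i hx; have := @flat x i.+1 hx; lia.
  have e : i = m by lia.
  by subst i; have := Dm1 x hx iM; have := @late x m hx; lia.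
- move=> i x a iM; rewrite pending_cat mem_cat => /orP[ha|].
    move=> hai; have := qi_late I iM (sub _ _ ha) hai.
    rewrite /raise; case hx: (same_row x t) => //=.
    (* The head of a sorted queue is at most every other waiting letter of its row. *)
    have ji : (j < i)%N.
      rewrite -(nth_lt x0 ss Ms) //; apply: le_lt_trans hai.
      have := qi_sorted I x; rewrite pj //= => /andP[/allP h _]; exact: h.
    rewrite ji ltnS (ltnW ji) /=.
    case: (ltngtP i m) => im; rewrite ?andbF //=.
      have := @flat x i hx; have := @flat x i.+1 hx; have := qi_ge I x iM; lia.
    by subst i; have := Dm1 x hx iM; lia.
  rewrite pending_bumped; case: ifP => // /andP[hm hx1]; rewrite inE => /eqP->.
  rewrite (nth_lt x0 ss Ms) // => mi.
  have [e _] := @fresh x i hx1 (introT andP (conj mi iM)).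
  have h1 : (j < i.+1 <= m)%N = false by lia.
  have h2 : (j < i <= m)%N = false by lia.
  by rewrite /raise h1 h2 !andbF.
- move=> x; rewrite pending_cat pairwise_cat pending_bumped.
  have srt : pairwise <=%O (pending x q).
    by have := qi_sorted I x; rewrite pending_cons; case: ifP => //= _ /andP[].
  (* By [fresh], nothing larger than [m] waits for the next row, so appending [m] keeps the
     order. *)
  rewrite srt /=; case: ifP => [/andP[hm hx1]|_]; last by rewrite allrel0r.
  rewrite allrel1r /= andbT; apply/allP => a ha /=.
  have [i iM e] := qi_letters I (sub _ _ ha).
  rewrite leNgt e (nth_lt x0 ss Ms) //; apply/negP => mi.
  have [_ /eqP] := @fresh x i hx1 (introT andP (conj mi iM)).
  by rewrite -leqn0 leqNgt -has_count has_pred1 -e sub.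
- move=> x a; rewrite pending_cat mem_cat => /orP[ha|]; first exact: (qi_letters I (sub _ _ ha)).
  by rewrite pending_bumped; case: ifP => // /andP[hm _]; rewrite inE => /eqP->; exists m.
Qed.

(** If the box after [D j.+1] lies in the row, it holds the leftmost larger letter, and [m] is the
    index of that letter; otherwise the row ends there and [m = M]. In both cases [insert_pair]
    performs [raise]. *)
Lemma insert_pair_step D R j t q :
  chain_tab x0 s M D R -> queue_inv D ((nth x0 s j, t) :: q) -> (j < M)%N ->
  exists R' m, [/\ (j < m <= M)%N,
    insert_pair n k R (nth x0 s j, t) = (R', ohead (bumped m t)),
    chain_tab x0 s M (raise D t j m) R' &
    queue_inv (raise D t j m) (q ++ bumped m t)].
Proof.
move=> [hin hout hent] I jM.
set r := (t mod kz k)%Z.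
have r_range : (0 <= r < kz k)%Z by apply: mod_range.
have lev := qi_levels I r.
(* Facts about the canonical row [r] are carried to all rows of its class by periodicity. *)
have rowE x i : same_row x t -> (i <= M)%N -> D i x = (D i r - (x / kz k) * nkz n k)%Z.
  by move=> /Z.eqb_spec hx iM; rewrite (periodic_mod x (qi_periodic I iM)) hx.
have step m : (j < m <= M)%N -> D m r = D j.+1 r ->
    ((m < M)%N -> (D m r < D m.+1 r)%Z) ->
    queue_inv (raise D t j m) (q ++ bumped m t).
  move=> /andP[jm mM] e lt; apply: queue_inv_step => // x hx.
    by rewrite (rowE x m) // (rowE x j.+1) // e.
  by move=> mM'; have := lt mM'; rewrite (rowE x m) // (rowE x m.+1) //; lia.
(* Writing letter [j] into the box after [D m] in row [r] gives exactly the raised chain. *)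
have entries m : (j < m <= M)%N -> D m r = D j.+1 r ->
    ((m < M)%N -> (D m r < D m.+1 r)%Z) -> forall r', (0 <= r' < kz k)%Z ->
    row_entries x0 s M (upd (ent R) (r, D m r + 1)%Z (nth x0 s j) r')
      (raise D t j m ^~ r').
  move=> hm e lt r' hr' i y iM; rewrite /upd /raise /=.
  have -> : same_row r' t = (r' =? r)%Z by rewrite /same_row Z.mod_small.
  case: (Z.eqb_spec r' r) => [->{r' hr'}|ne] /=; last by apply: hent.
  have flat i' : (j < i' <= m)%N -> D i' r = D m r.
    move=> hi'; have [h1 h2] : (j.+1 <= i')%N /\ (i' <= m)%N by lia.
    have mM : (m <= M)%N by lia.
    have := levels_le lev h1 (leq_trans h2 mM); have := levels_le lev h2 mM; lia.
  case: (Z.eqb_spec y (D m r + 1)) => [->|ne].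
    move=> hy; congr nth; apply/eqP; rewrite eqn_leq; apply/andP; split; rewrite leqNgt; apply/negP => ij.
      have := levels_le lev ij (ltnW jM); have := lev j jM; have := flat j.+1.
      move: hy; case: ifP; case: ifP; lia.
    case: (leqP i m) => im; first by have := flat i; have := flat i.+1; move: hy; case: ifP; case: ifP; lia.
    have h1 : (m.+1 <= i)%N by lia.
    have mM : (m < M)%N by lia.
    have := lt mM; have := levels_le lev h1 (ltnW iM); move: hy; case: ifP; case: ifP; lia.
  move=> hy; apply: hent => //; split; first by move: hy; case: ifP; case: ifP; lia.
  have := flat i.+1; move: hy; case: ifP; case: ifP; lia.
have inner' m x : inner R x = raise D t j m 0 x.
  by rewrite /raise ltn0 andbF hin.
rewrite /insert_pair row_ysE hin hout -/r (filter_zrange_gt ss Ms lev (hent r r_range) jM).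
case: (Z.ltb_spec (D j.+1 r) (D M r)) => hlt.
  rewrite (zrange_cat (mid := D j.+1 r + 1)%Z) ?zrange1; last lia.
  have [|m hm hmy] := level_between lev (y := (D j.+1 r + 1)%Z) jM (leqnn M); first lia.
  have mM : (m < M)%N by lia.
  have Dm : D m r = D j.+1 r.
    have h : (j.+1 <= m)%N by lia.
    have := levels_le lev h (ltnW mM); lia.
  have hjm : (j < m <= M)%N by lia.
  have lt : (m < M)%N -> (D m r < D m.+1 r)%Z by lia.
  exists (Tab (outer R) (inner R) (upd (ent R) (r, D j.+1 r + 1)%Z (nth x0 s j))), m.
  split=> //=.
  - by rewrite /bumped mM /= (hent r r_range m).
  - split=> //= [x|r' hr']; last by rewrite -Dm; apply: entries.
    by rewrite hout /raise (_ : (j < M <= m)%N = false) ?andbF //; lia.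
  - exact: step.
have Dm : D M r = D j.+1 r by have := levels_le lev jM (leqnn M); lia.
have hjm : (j < M <= M)%N by rewrite jM leqnn.
have lt : (M < M)%N -> (D M r < D M.+1 r)%Z by rewrite ltnn.
rewrite zrange_nil //=.
eexists; exists M; split; first by [].
- by rewrite /bumped ltnn.
- split=> //=; last by move=> r' hr'; apply: entries.
  move=> x; rewrite /add_box /= /raise hjm andbT /same_row -/r hout.
  case: Z.eqb_spec => // hx; rewrite (rowE x M) //; last by apply/Z.eqb_spec.
  lia.
- exact: step.
Qed.

(** * Bounds on the shapes and termination *)

(** The rule is monotone in [D i] and waiting letters only subtract, so [grow] bounds every
    intermediate shape. *)
Lemma queue_inv_le_grow D q b : queue_inv D q -> (forall x, D 0%N x = b x) ->
  forall i x, (i <= M)%N -> (D i x <= grow C b i x)%Z.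
Proof.
move=> I D0; elim=> [|i IH] x iM /=; first by rewrite D0; lia.
rewrite (qi_balance I x iM); have := IH x (ltnW iM); have := IH (x - 1)%Z (ltnW iM); lia.
Qed.

(** With nothing waiting, the balance is the recursion of [grow]. *)
Lemma queue_inv_nil D b : queue_inv D [::] -> (forall x, D 0%N x = b x) ->
  forall i x, (i <= M)%N -> D i x = grow C b i x.
Proof.
move=> I D0; elim=> [|i IH] x iM /=; first by rewrite D0.
by rewrite (qi_balance I x iM) /= !(IH _ (ltnW iM)); lia.
Qed.

(** Termination measure: the total room left below the bound [L], over one period of rows and all
    levels. *)
Definition distance (L D : nat -> cshape) : nat :=
  \sum_(p : 'I_M.+1 * 'I_k) Z.to_nat (L p.1 (Z.of_nat p.2) - D p.1 (Z.of_nat p.2)).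

Lemma distance_raise L D t j m : (j < m <= M)%N ->
  (forall i x, (i <= M)%N -> (raise D t j m i x <= L i x)%Z) ->
  (distance L (raise D t j m) < distance L D)%N.
Proof.
move=> hm le; have hr := mod_range t.
have iM : (j.+1 < M.+1)%N by lia.
have rk : (Z.to_nat (t mod kz k) < k)%N by move: hr; rewrite /kz; lia.
(* Level [j.+1] in the canonical row of [t] is a term that strictly drops. *)
rewrite /distance [X in (X < _)%N](bigD1 (Ordinal iM, Ordinal rk)) //=.
rewrite [X in (_ < X)%N](bigD1 (Ordinal iM, Ordinal rk)) //= -addSn.
apply: leq_add; last first.
  by apply: leq_sum => p _; rewrite /raise; case: ifP; lia.
have -> : Z.of_nat (Z.to_nat (t mod kz k)) = (t mod kz k)%Z by lia.
have := le j.+1 (t mod kz k)%Z iM; rewrite /raise.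
have -> : same_row (t mod kz k) t by rewrite /same_row Z.mod_mod //; lia.
have -> : (j < j.+1 <= m)%N by lia.
rewrite /=; lia.
Qed.

(** The invariant concerns [q ++ q'], the rest of the round followed by what it has produced, so the
    rounds act as a single first-in first-out queue. Each insertion costs at least one unit of
    [distance]. *)
Lemma round_inv b q R q' D :
  chain_tab x0 s M D R -> queue_inv D (q ++ q') -> (forall x, D 0%N x = b x) ->
  let: (R1, q1) := foldl (fun st p => let: (R0, q') := st in
                     let: (R1, o) := insert_pair n k R0 p in
                     (R1, match o with None => q' | Some p' => rcons q' p' end))
        (R, q') q in
  exists D', [/\ chain_tab x0 s M D' R1, queue_inv D' q1, forall x, D' 0%N x = b x &
    (distance (grow C b) D' + size q <= distance (grow C b) D)%N].
Proof.
elim: q R q' D => [|[a t] q IH] R q' D hR I D0 /=; first by exists D; rewrite addn0.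
have [|j jM e] := qi_letters I (x := t) (a := a).
  by rewrite pending_cons /= /same_row Z.eqb_refl mem_head.
rewrite {}e in I *.
have [R' [m [hm eR' hR' I']]] := insert_pair_step hR I jM.
have D0' x : raise D t j m 0 x = b x by rewrite /raise ltn0 andbF.
have lt := distance_raise hm (queue_inv_le_grow I' D0').
rewrite /insert_pair -/insert_pair in eR' *; rewrite eR'.
set q'' := match _ with None => _ | Some _ => _ end.
have eq'' : q'' = q' ++ bumped m t.
  by rewrite /q'' /bumped; case: ifP => _ /=; rewrite ?cats1 ?cats0.
have := IH R' q'' (raise D t j m) hR'; rewrite eq'' catA => /(_ I' D0').
case: (foldl _ _ _) => R1 q1 [D' [h1 h2 h3 h4]]; exists D'; split=> //.
by apply: leq_trans lt; rewrite addnS.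
Qed.

Lemma chain_tab_ext D D' R : (forall i x, (i <= M)%N -> D i x = D' i x) ->
  chain_tab x0 s M D R -> chain_tab x0 s M D' R.
Proof.
move=> e [h1 h2 h3]; split=> [x|x|r hr i y iM /=]; rewrite -?e //; first exact: h3.
exact: ltnW.
Qed.

(** A nonempty round lowers [distance], which therefore bounds the number of rounds. Correctness is
    kept apart: it holds for any fuel with which the loop ends. *)
Lemma bump_loop_inv b fuel R q D :
  chain_tab x0 s M D R -> queue_inv D q -> (forall x, D 0%N x = b x) ->
  ((distance (grow C b) D <= fuel)%N -> exists R', bump_loop n k fuel R q = Some R') /\
  (forall R', bump_loop n k fuel R q = Some R' -> chain_tab x0 s M (grow C b) R').
Proof.
elim: fuel R q D => [|fuel IH] R [|p q] D hR I D0 /=.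
- split; first by exists R.
  by move=> _ [<-]; apply: chain_tab_ext hR => i x; apply: queue_inv_nil.
- split=> // le.
  have := @round_inv b (p :: q) R [::] D hR; rewrite cats0 => /(_ I D0).
  by case: (foldl _ _ _) => R1 q1 [D' [_ _ _ /=]]; lia.
- split; first by exists R.
  by move=> _ [<-]; apply: chain_tab_ext hR => i x; apply: queue_inv_nil.
have := @round_inv b (p :: q) R [::] D hR; rewrite cats0 => /(_ I D0).
rewrite /round [foldl _ _ (p :: q)]/=.
case: (foldl _ _ _) => R1 q1 [D' [h1 h2 h3 h4]].
have [h5 h6] := IH R1 q1 D' h1 h2 h3; split=> // le.
by apply: h5; move: h4 => /=; lia.
Qed.

(** * The initial phase of multi-insertion *)

Section FullMulti.
Variables (R : tableau A) (S : seq box) (b : cshape).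
Hypothesis C_periodic : forall i, (i <= M)%N -> periodic (C i).
Hypothesis b_periodic : periodic b.
Hypothesis C0b : forall x, (C 0%N x <= b x)%Z.
Hypothesis R_chain : chain_tab x0 s M C R.
Hypothesis S_strip : is_strip S (C 0%N) b.

(** The inner loop body of [init_phase], named to allow induction; [init_row] is the outer one. *)
Definition init_box (h : nat) (st : tableau A * seq (A * Z)) (b : box) :=
  let: (R0, q) := st in
  if in_shape (outer R0) b
  then (R0, rcons q (ent R0 b.1 b.2, Z.of_nat h + 1)%Z)
  else (Tab (add_box n k (outer R0) b) (inner R0) (ent R0), q).

Definition init_row (st : tableau A * seq (A * Z)) (h : nat) :=
  foldl (init_box h) st (sort (fun b1 b2 : box => (b1.2 <=? b2.2)%Z) [seq b <- S | (b.1 =? Z.of_nat h)%Z]).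

(** The minimum separates the boxes of the strip inside the outer shape, whose letters are queued,
    from those that extend it. *)
Definition bumped_row (h : nat) : seq (A * Z) :=
  [seq (ent R (Z.of_nat h) y, Z.of_nat h + 1)%Z
    | y <- zrange (C 0%N (Z.of_nat h)) (Z.min (b (Z.of_nat h)) (C M (Z.of_nat h)))].

(** From left to right, boxes up to the end of the row are queued and each later one prolongs the
    row by one; so no box falls inside the shape because of earlier additions. *)
Lemma init_rowP R0 q h : (h < k)%N -> ent R0 = ent R -> periodic (outer R0) ->
  outer R0 (Z.of_nat h) = C M (Z.of_nat h) ->
  exists R1, [/\ init_row (R0, q) h = (R1, q ++ bumped_row h),
    ent R1 = ent R, inner R1 = inner R0 &
    forall x, outer R1 x = if (x mod kz k =? Z.of_nat h)%Z
                           then Z.max (outer R0 x) (b x) else outer R0 x].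
Proof.
move=> hk eR0 pR0 oR0.
have hh : (0 <= Z.of_nat h < kz k)%Z by rewrite /kz; lia.
rewrite /init_row (proj2 S_strip) // /bumped_row -oR0 -eR0.
have lo : (C 0%N (Z.of_nat h) <= outer R0 (Z.of_nat h))%Z.
  by rewrite oR0; apply: (levels_le (@C_levels (Z.of_nat h))).
have perR0 x : (x mod kz k = Z.of_nat h)%Z ->
    outer R0 x = (outer R0 (Z.of_nat h) - (x / kz k) * nkz n k)%Z.
  by move=> <-; apply: periodic_mod.
(* The end of the strip becomes a constant, which can be generalized and reached box by box. *)
suff: exists R1, [/\ foldl (init_box h) (R0, q)
       [seq (Z.of_nat h, y) | y <- zrange (C 0%N (Z.of_nat h)) (b (Z.of_nat h))] =
     (R1, q ++ [seq (ent R0 (Z.of_nat h) y, Z.of_nat h + 1)%Z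
         | y <- zrange (C 0%N (Z.of_nat h)) (Z.min (b (Z.of_nat h)) (outer R0 (Z.of_nat h)))]),
     ent R1 = ent R0, inner R1 = inner R0 &
     forall x, outer R1 x = if (x mod kz k =? Z.of_nat h)%Z
        then Z.max (outer R0 x) (b (Z.of_nat h) - (x / kz k) * nkz n k) else outer R0 x].
  move=> [R1 [-> h2 h3 h4]]; exists R1; split=> // x; rewrite h4.
  by case: Z.eqb_spec => // hx; rewrite (periodic_mod x b_periodic) hx.
move: (b _) (@C0b (Z.of_nat h)) => bh hbh.
elim/zrange_ind: hbh => [|hi hlo [R1 [e1 e2 e3 e4]]].
  exists R0; rewrite Z.min_l // zrange_nil /= ?cats0; last lia.
  split=> // x; case: Z.eqb_spec => // hx; rewrite perR0 //; lia.
rewrite zrange_rcons // map_rcons foldl_rcons e1 /init_box /in_shape /= e4 Z.mod_small // Z.eqb_refl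
  Z.div_small //.
case: Z.leb_spec => cmp.
  exists R1; rewrite e2; split=> //.
    rewrite !Z.min_l; try lia.
    by rewrite zrange_rcons // map_rcons -rcons_cat.
  by move=> x; rewrite e4; case: Z.eqb_spec => // hx; rewrite perR0 //; lia.
exists (Tab (add_box n k (outer R1) (Z.of_nat h, hi + 1)%Z) (inner R1) (ent R1)).
split=> //=; first by rewrite !Z.min_r //; lia.
move=> x; rewrite /add_box /= e4; case: Z.eqb_spec => // hx; lia.
Qed.

Lemma init_rowsP j : (j <= k)%N ->
  exists R1, [/\ foldl init_row (R, [::]) (iota 0 j) =
                 (R1, flatten [seq bumped_row h | h <- iota 0 j]),
    ent R1 = ent R, inner R1 = inner R &
    forall x, outer R1 x = if (x mod kz k <? Z.of_nat j)%Z
                           then Z.max (C M x) (b x) else C M x].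
Proof.
have [_ oR _] := R_chain.
elim: j => [|j IH] hj.
  exists R; split=> // x; have := mod_range x; case: Z.ltb_spec; first lia.
  by rewrite oR.
have [R1 [e1 e2 e3 e4]] := IH (ltnW hj).
have jk : (0 <= Z.of_nat j < kz k)%Z by rewrite /kz; lia.
have pR1 : periodic (outer R1).
  move=> x; rewrite !e4.
  have -> : ((x + kz k) mod kz k = x mod kz k)%Z.
    by rewrite -{1}(Z.mul_1_l (kz k)) Z_mod_plus_full.
  have := C_periodic (leqnn M) x; have := b_periodic x; case: Z.ltb_spec; lia.
have [|R2 [f1 f2 f3 f4]] := init_rowP (flatten [seq bumped_row h | h <- iota 0 j]) hj e2 pR1.
  by rewrite e4 Z.mod_small //; case: Z.ltb_spec => //; lia.
exists R2; split=> //.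
- by rewrite -addn1 iotaD foldl_cat e1 /= f1 map_cat flatten_cat /= cats0.
- by rewrite f3.
- move=> x; rewrite f4 e4; have := mod_range x.
  by case: Z.eqb_spec; case: Z.ltb_spec; case: Z.ltb_spec; lia.
Qed.

(** Only row [x - 1] feeds row [x], so one row of the queue survives the filter. *)
Lemma pending_bumped_rows x :
  pending x (flatten [seq bumped_row h | h <- iota 0 k]) =
  [seq ent R ((x - 1) mod kz k) y
    | y <- zrange (C 0%N ((x - 1) mod kz k))%Z
             (Z.min (b ((x - 1) mod kz k)) (C M ((x - 1) mod kz k)))%Z].
Proof.
have := mod_range (x - 1); set r := ((x - 1) mod kz k)%Z => hr.
have e : r = Z.of_nat (Z.to_nat r) by lia.
rewrite e -/r /pending (@filter_flatten_iota _ _ bumped_row (Z.to_nat r)).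
- by rewrite /bumped_row -map_comp; apply: eq_map.
- by rewrite /kz in hr; lia.
- move=> i ik ne; rewrite /bumped_row all_map; apply/allP => y _ /=.
  rewrite same_row_sym /same_row -mod_succ -/r [(_ mod kz k)%Z]Z.mod_small; last by rewrite /kz; lia.
  by apply/negP => /Z.eqb_spec; lia.
- rewrite /bumped_row all_map; apply/allP => y _ /=.
  by rewrite same_row_sym /same_row -mod_succ -/r -e Z.mod_small ?Z.eqb_refl.
Qed.

(** The copies of letter [i] queued from row [x - 1] number [min (C i.+1) b - min (C i) b]. This
    equals [min (C i.+1) (max (C i) b) - C i], so outflow and waiting letters cancel in the
    balance. *)
Lemma init_queue_inv :
  queue_inv (fun i x => Z.max (C i x) (b x)) (flatten [seq bumped_row h | h <- iota 0 k]).
Proof.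
have [_ _ entR] := R_chain.
(* The end points of the part of row [r] that lies in [b]. *)
pose c r i := Z.min (b r) (C i r).
have c_lev r : levels M (c r).
  by move=> i iM; have := @C_levels r i iM; rewrite /c; lia.
have c_ent r : (0 <= r < kz k)%Z -> row_entries x0 s M (ent R r) (c r).
  by move=> hr i y iM hy; apply: entR => //=; rewrite /c in hy; lia.
have c0 r : C 0%N r = c r 0%N by rewrite /c; have := @C0b r; lia.
have letter x a : a \in pending x (flatten [seq bumped_row h | h <- iota 0 k]) ->
    exists2 j, (j < M)%N & a = nth x0 s j.
  rewrite pending_bumped_rows c0 => /mapP[y /mem_zrange hy ->].
  have [j hj hyj] := level_between (c_lev _) (leq0n M) (leqnn M) hy.
  by exists j => //; apply: c_ent => //; apply: mod_range.
split=> //.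
- by move=> i iM x; have := C_periodic iM x; have := b_periodic x; lia.
- by move=> x i iM; have := @C_levels x i iM; rewrite /=; lia.
- by move=> i x iM; lia.
- move=> i x iM; rewrite pending_bumped_rows count_map.
  set r := ((x - 1) mod kz k)%Z.
  have hr : (0 <= r < kz k)%Z by apply: mod_range.
  rewrite c0 -size_filter (filter_zrange_eq ss Ms (c_lev r) (c_ent r hr) iM).
  rewrite /zrange size_map size_iota.
  have := @C_levels r i iM; have := @C_levels x i iM; rewrite /c /=.
  rewrite (periodic_mod (x - 1)%Z (C_periodic (ltnW iM))) (periodic_mod (x - 1)%Z (C_periodic iM)).
  rewrite (periodic_mod (x - 1)%Z b_periodic) -/r; lia.
- by move=> i x a iM _ _; have := @C_levels x i iM; rewrite /=; lia.
- move=> x; rewrite pending_bumped_rows -sorted_pairwise; last exact: le_trans.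
  set r := ((x - 1) mod kz k)%Z.
  have hr : (0 <= r < kz k)%Z by apply: mod_range.
  rewrite c0 -/(c r M); apply: (homo_sorted_in (P := mem (zrange (c r 0%N) (c r M)))); last 2 first.
  + exact/allP.
  + exact: sorted_zrange.
  move=> y1 y2 /mem_zrange h1 /mem_zrange h2 /Z.leb_spec0 le12.
  have [i1 hi1 hy1] := level_between (c_lev r) (leq0n M) (leqnn M) h1.
  have [i2 hi2 hy2] := level_between (c_lev r) (leq0n M) (leqnn M) h2.
  rewrite (c_ent r hr i1) // (c_ent r hr i2) // leNgt (nth_lt x0 ss Ms) //.
  apply/negP => i21; have := levels_le (c_lev r) i21 (ltnW hi1); lia.
Qed.

(** Fuel measured from [C] suffices: the loop starts from the larger chain [max (C i) b], whose
    distance to [grow C b] is no greater. *)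
Lemma full_multi_chain fuel :
  ((distance (grow C b) C <= fuel)%N -> exists R', full_multi n k fuel R S = Some R') /\
  (forall R', full_multi n k fuel R S = Some R' -> chain_tab x0 s M (grow C b) R').
Proof.
have [R1 [e1 e2 e3 e4]] := init_rowsP (leqnn k).
rewrite /full_multi (_ : init_phase n k R S = foldl init_row (R, [::]) (iota 0 k)) // e1.
set R2 := Tab _ _ _; have [iR oR entR] := R_chain.
have R2_chain : chain_tab x0 s M (fun i x => Z.max (C i x) (b x)) R2.
  split=> [x|x|r hr i y iM] /=.
  - rewrite e3 (strip_union (C_periodic (leq0n M)) b_periodic S_strip) //; have := @C0b x; lia.
  - by rewrite e4; have := mod_range x; rewrite /kz; case: Z.ltb_spec => //; lia.
  - by rewrite e2 => hy; apply: entR => //; lia.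
have [|h1 h2] := @bump_loop_inv b fuel _ _ _ R2_chain init_queue_inv.
  by move=> x; have := @C0b x; lia.
split=> // le; apply: h1; apply: leq_trans le.
by apply: leq_sum => p _; lia.
Qed.

End FullMulti.

End Queue.

(** * Chains of shapes in the growth diagram *)

Definition is_chain (M : nat) (C : nat -> cshape) : Prop :=
  (forall i, (i <= M)%N -> periodic (C i)) /\ forall x, levels M (C^~ x).

(** Both arguments of the minimum in row [x - 1] are at least [C i], so the rule adds a nonnegative
    outflow. *)
Lemma grow_ge M C b : (forall x, levels M (C^~ x)) -> (forall x, (C 0%N x <= b x)%Z) ->
  forall i x, (i <= M)%N -> (C i x <= grow C b i x)%Z.
Proof.
move=> lev C0; elim=> [|i IH] x iM /=; first exact: C0.
have := IH x (ltnW iM); have := IH (x - 1)%Z (ltnW iM).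
have := @lev x i iM; have := @lev (x - 1)%Z i iM; rewrite /=; lia.
Qed.

Lemma grow_chain M C b : is_chain M C -> periodic b -> (forall x, (C 0%N x <= b x)%Z) ->
  is_chain M (grow C b).
Proof.
move=> [per lev] hb C0; split.
  elim=> [//|i IH] iM x /=.
  have := IH (ltnW iM) x; have := IH (ltnW iM) (x - 1)%Z.
  have := per _ iM x; have := per _ iM (x - 1)%Z; have := per _ (ltnW iM) (x - 1)%Z.
  have -> : (x + kz k - 1 = x - 1 + kz k)%Z by lia.
  lia.
move=> x i iM /=; have := @grow_ge M C b lev C0 i (x - 1)%Z (ltnW iM).
have := @lev (x - 1)%Z i iM; rewrite /=; lia.
Qed.

Lemma grid_chain M N Ac Bc : is_chain M Ac -> is_chain N Bc ->
  (forall x, Ac 0%N x = Bc 0%N x) -> forall j, (j <= N)%N -> is_chain M (grid Ac Bc j).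
Proof.
move=> hA hB e; elim=> [//|j IH] jN /=.
apply: grow_chain; [exact: IH (ltnW jN) | exact: (proj1 hB) |].
by move=> x; rewrite grid0 //; apply: (proj2 hB x j jN).
Qed.

(** * Semistandard tableaux as chains *)

Section Crsk.
Variables (d : Order.disp_t) (A : orderType d) (x0 : A).

Lemma mem_skew_boxes l mu r y : (0 <= r < kz k)%Z -> (mu r < y <= l r)%Z ->
  (r, y) \in skew_boxes k l mu.
Proof.
move=> hr hy; apply/flatten_mapP; exists (Z.to_nat r).
  by rewrite mem_iota; move: hr; rewrite /kz; lia.
have -> : Z.of_nat (Z.to_nat r) = r by lia.
by apply: map_f; rewrite row_ysE; apply/mem_zrange.
Qed.

(** Filtering by letter and by row commute; within one row the letter fills one step of the chain,
    already in sorted order. *)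
Lemma boxes_with_strip (us : seq A) N Bc (U : tableau A) j :
  sorted <%O us -> (N <= size us)%N -> (forall x, levels N (Bc^~ x)) ->
  chain_tab x0 us N Bc U -> (j < N)%N ->
  is_strip (boxes_with k U (nth x0 us j)) (Bc j) (Bc j.+1).
Proof.
move=> us_sorted Ns lev [inU outU entU] jN; split.
  move=> p; rewrite mem_filter => /andP[_ /flatten_mapP[h]].
  by rewrite mem_iota => hh /mapP[y _ ->] /=; rewrite /kz; lia.
move=> h hk; have hh : (0 <= Z.of_nat h < kz k)%Z by rewrite /kz; lia.
rewrite /boxes_with -filter_predI.
under eq_filter do rewrite /= andbC.
rewrite [X in sort _ X](_ : _ = [seq p <- [seq p <- skew_boxes k (outer U) (inner U)
   | (p.1 =? Z.of_nat h)%Z] | ent U p.1 p.2 == nth x0 us j]); last by rewrite -filter_predI.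
rewrite /skew_boxes (@filter_flatten_iota _ _ _ h) //; first last.
- by rewrite all_map; apply/allP => y _ /=; rewrite Z.eqb_refl.
- by move=> i _ ne; rewrite all_map; apply/allP => y _ /=; lia.
rewrite filter_map row_ysE inU outU.
rewrite (@filter_zrange_eq _ _ x0 us us_sorted N Ns (ent U (Z.of_nat h)) (Bc^~ (Z.of_nat h))) //; last exact: entU.
apply: sorted_sort; first by move=> [? ?] [? ?] [? ?] /=; lia.
by rewrite sorted_map; apply: sorted_zrange.
Qed.

Lemma letters_sorted (T : tableau A) : sorted <%O (letters k T).
Proof. by rewrite /letters sort_lt_sorted undup_uniq. Qed.

(** The letters of index below [i] form an initial segment of each row by weak increase, so counting
    them gives the end point [C i]. *)
Lemma SSCT_chain (T : tableau A) al mu : cylindric n k al -> cylindric n k mu ->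
  subshape mu al -> is_SSCT n k T al mu ->
  exists C, [/\ is_chain (size (letters k T)) C,
    chain_tab x0 (letters k T) (size (letters k T)) C T & forall x, C 0%N x = mu x].
Proof.
move=> [_ al_per] [_ mu_per] mu_al [outT [inT [rowT _]]].
set ts := letters k T; have tss : sorted <%O ts by apply: letters_sorted.
pose p r i : pred Z := fun y => (index (ent T r y) ts < i)%N.
pose row r := zrange (mu r) (al r).
(* Counting in the canonical row and adding to [mu] makes every level periodic. *)
pose C i x := (mu x + Z.of_nat (count (p (x mod kz k)%Z i) (row (x mod kz k)%Z)))%Z.
have mem_ts r y : (0 <= r < kz k)%Z -> (mu r < y <= al r)%Z -> ent T r y \in ts.
  move=> hr hy; rewrite mem_sort mem_undup.
  apply: (map_f (fun b : box => ent T b.1 b.2) (x := (r, y))).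
  by apply: mem_skew_boxes; rewrite // outT inT.
have C0 x : C 0%N x = mu x by rewrite /C (eq_count (a2 := pred0)) ?count_pred0; last by []; lia.
have initial r i : (0 <= r < kz k)%Z -> forall y1 y2, (mu r < y1)%Z -> (y1 < y2)%Z ->
    (y2 <= al r)%Z -> p r i y2 -> p r i y1.
  move=> hr y1 y2 h1 h2 h3; rewrite /p => hi.
  have hp y : pent n k T r y = ent T r y.
    by rewrite /pent /canon /= Z.mod_small // Z.div_small // Z.mul_0_l Z.add_0_r.
  apply: leq_ltn_trans hi; rewrite leqNgt; apply/negP => lt.
  have m1 : ent T r y1 \in ts by apply: mem_ts => //; lia.
  have m2 : ent T r y2 \in ts by apply: mem_ts => //; lia.
  have := rowT r y1 y2; rewrite !hp /in_skew leNgt => /(_ _ _ h2) /negP; case; try lia.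
  rewrite -(nth_index x0 m1) -(nth_index x0 m2).
  by rewrite lt_sorted_ltn_nth // inE index_mem.
have C_row i r y : (0 <= r < kz k)%Z -> (mu r < y <= al r)%Z ->
    (index (ent T r y) ts < i)%N = (y <=? C i r)%Z.
  move=> hr hy; rewrite /C Z.mod_small //.
  exact: (filter_zrange_initial (p := p r i) (mu_al r) (initial r i hr) hy).
have C_le i x : (mu x <= C i x <= al x)%Z.
  rewrite (periodic_mod x al_per) (periodic_mod x mu_per) /C.
  have := count_size (p (x mod kz k)%Z i) (row (x mod kz k)%Z).
  rewrite /row /zrange size_map size_iota (periodic_mod x mu_per); have := mu_al (x mod kz k)%Z; lia.
exists C; split=> //; first split.
- move=> i _ x; rewrite /C.
  have -> : ((x + kz k) mod kz k = x mod kz k)%Z.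
    by rewrite -{1}(Z.mul_1_l (kz k)) Z_mod_plus_full.
  by have := mu_per x; lia.
- move=> x i _ /=; rewrite /C.
  have : (count (p (x mod kz k)%Z i) (row (x mod kz k)%Z)
          <= count (p (x mod kz k)%Z i.+1) (row (x mod kz k)%Z))%N.
    by apply: sub_count => y; rewrite /p; lia.
  lia.
- have C_size x : C (size ts) x = al x.
    rewrite /C (periodic_mod x al_per) (periodic_mod x mu_per).
    have -> : count (p (x mod kz k)%Z (size ts)) (row (x mod kz k)%Z) = size (row (x mod kz k)%Z).
      apply/eqP; rewrite -all_count; apply/allP => y /mem_zrange hy.
      by rewrite /p index_mem; apply: mem_ts => //; apply: mod_range.
    rewrite /row /zrange size_map size_iota; have := mu_al (x mod kz k)%Z; lia.
  split=> [x|x|r hr i y isz /= hy]; rewrite ?C0 ?C_size //.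
  have hy' : (mu r < y <= al r)%Z by have := C_le i r; have := C_le i.+1 r; lia.
  (* By [C_row], the index is below [i.+1] but not below [i]. *)
  have e : index (ent T r y) ts = i.
    have h1 := C_row i r y hr hy'; have h2 := C_row i.+1 r y hr hy'.
    lia.
  by rewrite -e nth_index //; apply: mem_ts.
Qed.

(** * The run of CRSK along the growth diagram *)

Section Run.
Variables (ts us : seq A) (Ac Bc : nat -> cshape) (T U : tableau A).
Hypothesis ts_sorted : sorted <%O ts.
Hypothesis us_sorted : sorted <%O us.
Hypothesis A_chain : is_chain (size ts) Ac.
Hypothesis B_chain : is_chain (size us) Bc.
Hypothesis AB0 : forall x, Ac 0%N x = Bc 0%N x.
Hypothesis T_chain : chain_tab x0 ts (size ts) Ac T.
Hypothesis U_chain : chain_tab x0 us (size us) Bc U.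
Local Notation G := (grid Ac Bc).
Local Notation M := (size ts).

Definition crsk_state (fuel j : nat) : option (tableau A * tableau A) :=
  foldl (crsk_step n k fuel U) (Some (T, Tab (outer T) (outer T) (ent T))) (take j us).

(** Letter [j] of [U] occupies the strip [Bc j.+1 / Bc j], and inserting it moves [P] from [G j] to
    [G j.+1], while [Q] records the outer shapes [G i M]. The fuel only has to cover each single
    step. *)
Lemma crsk_state_chain fuel j : (j <= size us)%N ->
  ((forall i, (i < j)%N -> (distance M (G i.+1) (G i) <= fuel)%N) ->
     exists P Q, crsk_state fuel j = Some (P, Q)) /\
  (forall P Q, crsk_state fuel j = Some (P, Q) ->
     chain_tab x0 ts M (G j) P /\ chain_tab x0 us j (fun i => G i M) Q).
Proof.
elim: j => [|j IH] jN.
  rewrite /crsk_state take0 /=; split; first by eexists; eexists.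
  move=> P Q [<- <-]; split=> //; have [_ oT _] := T_chain.
  by split.
have [IH1 IH2] := IH (ltnW jN).
have crskS : crsk_state fuel j.+1 = crsk_step n k fuel U (crsk_state fuel j) (nth x0 us j).
  by rewrite /crsk_state (take_nth x0) // foldl_rcons.
have Gj := grid_chain A_chain B_chain AB0 (ltnW jN).
have GjB x : (G j 0 x <= Bc j.+1 x)%Z.
  by rewrite grid0 //; apply: (proj2 B_chain x j jN).
have fm P : chain_tab x0 ts M (G j) P ->
    ((distance M (G j.+1) (G j) <= fuel)%N ->
      exists P', full_multi n k fuel P (boxes_with k U (nth x0 us j)) = Some P') /\
    (forall P', full_multi n k fuel P (boxes_with k U (nth x0 us j)) = Some P' ->
      chain_tab x0 ts M (G j.+1) P').
  move=> hP; apply: full_multi_chain => //; try exact: (proj1 Gj); try exact: (proj2 Gj).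
    exact: (proj1 B_chain).
  have [h1 h2] := boxes_with_strip us_sorted (leqnn _) (proj2 B_chain) U_chain jN.
  by split=> // h hk; rewrite h2 // -(@grid0 Ac Bc j (Z.of_nat h) AB0).
rewrite crskS; split.
  move=> hf; have [|P [Q e]] := IH1; first by move=> i ij; apply: hf; apply: ltnW.
  have [hP _] := IH2 _ _ e; have [|P' e'] := (fm P hP).1; first exact: hf.
  by rewrite e /= e'; eexists; eexists.
case e: (crsk_state fuel j) => [[P Q]|//] P1 Q1 /=.
have [hP hQ] := IH2 _ _ e; case e': (full_multi _ _ _ _ _) => [P'|//] [<- <-].
have hP' := (fm P hP).2 _ e'; split=> //.
have [_ oP _] := hP; have [_ oP' _] := hP'; have [iQ _ eQ] := hQ.
(* Outer shapes grow, so boxes of [Q] filled earlier lie inside [P] and keep their letters. *)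
have mono i r : (i < size us)%N -> (G i M r <= G i.+1 M r)%Z.
  move=> iN; apply: (grow_ge (M := M)) => //.
    exact: (proj2 (grid_chain A_chain B_chain AB0 (ltnW iN))).
  by move=> x; rewrite grid0 //; apply: (proj2 B_chain x i iN).
split=> //= r hr i y; rewrite ltnS leq_eqVlt => /orP[/eqP->|ij] /=.
  move=> [/Z.leb_gt hy1 /Z.leb_le hy2].
  by rewrite /in_shape /= oP oP' hy1 hy2.
move=> hy; rewrite /in_shape /= oP.
have le : (G i.+1 M r <= G j M r)%Z.
  apply: (@levels_le j (fun i => G i M r)) => //.
  by move=> i' i'j; apply: mono; apply: leq_trans jN; apply: ltnW.
have /Z.leb_le-> : (y <= G j M r)%Z by apply: Z.le_trans le; case: hy.
by rewrite andbF; apply: eQ.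
Qed.

Hypothesis us_letters : us = letters k U.

Lemma crsk_runE fuel : crsk_run n k fuel T U =
  if crsk_state fuel (size us) is Some (P, Q) then Some (P, Q, outer P) else None.
Proof. by rewrite /crsk_run /crsk_state take_size us_letters. Qed.

Lemma crsk_run_terminates : exists fuel P Q lam, crsk_run n k fuel T U = Some (P, Q, lam).
Proof.
pose F (i : 'I_(size us)) := distance M (G i.+1) (G i).
exists (\max_(i < size us) F i).
have [terminates _] := @crsk_state_chain (\max_(i < size us) F i) (size us) (leqnn _).
have [|P [Q e]] := terminates.
  by move=> i iN; apply: (leq_bigmax (F := F) (Ordinal iN)).
by rewrite crsk_runE e; exists P, Q, (outer P).
Qed.

Lemma crsk_run_chain fuel P Q lam : crsk_run n k fuel T U = Some (P, Q, lam) ->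
  [/\ chain_tab x0 ts M (G (size us)) P, chain_tab x0 us (size us) (fun i => G i M) Q
    & lam = outer P].
Proof.
rewrite crsk_runE; case e: (crsk_state _ _) => [[P' Q']|//] [<- <- <-].
by have [h1 h2] := (@crsk_state_chain fuel (size us) (leqnn _)).2 _ _ e.
Qed.

End Run.

(** Every box lies in some step of the chain, so the chain determines all entries. *)
Lemma chain_tab_eq (s : seq A) M C (R1 R2 : tableau A) : (forall x, levels M (C^~ x)) ->
  chain_tab x0 s M C R1 -> chain_tab x0 s M C R2 -> tab_eq k R1 R2.
Proof.
move=> lev [i1 o1 e1] [i2 o2 e2]; split; first by move=> x; rewrite o1 o2.
split; first by move=> x; rewrite i1 i2.
move=> r y hr; rewrite i1 o1 => hy.
have [m hm hmy] := level_between (lev r) (leq0n M) (leqnn M) hy.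
by rewrite (e1 r hr m) ?(e2 r hr m).
Qed.

End Crsk.
End Rows.

(** * Transposing the growth diagram *)

Theorem mainTheorem4 (n k : nat) (hk : (1 <= k)%N) (hnk : (k < n)%N)
  (d : Order.disp_t) (A : orderType d)
  (mu alpha beta : cshape)
  (hmu : cylindric n k mu) (halpha : cylindric n k alpha) (hbeta : cylindric n k beta)
  (hma : subshape mu alpha) (hmb : subshape mu beta)
  (T U : tableau A)
  (hT : is_SSCT n k T alpha mu) (hU : is_SSCT n k U beta mu)
  (P Q : tableau A) (lam : cshape) :
  CRSK_is n k T U P Q lam -> CRSK_is n k U T Q P lam.
Proof.
(* A default letter for [nth]; the entry function of [T] supplies one even when the shape is
   empty. *)
pose x0 := ent T 0%Z 0%Z.
have [Ac [A_chain T_chain A0]] := SSCT_chain hk x0 halpha hmu hma hT.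
have [Bc [B_chain U_chain B0]] := SSCT_chain hk x0 hbeta hmu hmb hU.
have AB0 x : Ac 0%N x = Bc 0%N x by rewrite A0 B0.
have BA0 x : Bc 0%N x = Ac 0%N x by rewrite A0 B0.
have tss := letters_sorted k T; have uss := letters_sorted k U.
move=> [fuel [P1 [Q1 [lam1 [run1 [eP [eQ elam]]]]]]].
have [hP1 hQ1 elam1] :=
  crsk_run_chain hk tss uss A_chain B_chain AB0 T_chain U_chain erefl run1.
(* The exchanged run needs its own fuel, which termination provides. *)
have [fuel2 [Q2 [P2 [lam2 run2]]]] :=
  crsk_run_terminates hk uss tss B_chain A_chain BA0 U_chain T_chain erefl.
have [hQ2 hP2 elam2] :=
  crsk_run_chain hk uss tss B_chain A_chain BA0 U_chain T_chain erefl run2.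
exists fuel2, Q2, P2, lam2; split=> //.
have trans (R1 R2 R3 : tableau A) : tab_eq k R1 R2 -> tab_eq k R2 R3 -> tab_eq k R1 R3.
  move=> [o1 [i1 e1]] [o2 [i2 e2]]; split; first by move=> x; rewrite o1 o2.
  split; first by move=> x; rewrite i1 i2.
  by move=> r y hr hy; rewrite e1 // e2 // -?i1 -?o1.
(* The chain of [Q1] is the last column of the diagram, that of [Q2] the last row of the transposed
   one. *)
have QQ : tab_eq k Q1 Q2.
  apply: chain_tab_eq hQ2; first exact: (proj2 (grid_chain hk B_chain A_chain BA0 (leqnn _))).
  by apply: chain_tab_ext hQ1 => i x _; apply: grid_sym.
have PP : tab_eq k P1 P2.
  apply: chain_tab_eq hP2; last first.
    by apply: chain_tab_ext hP1 => i x _; apply: grid_sym.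
  move=> x i iM; rewrite -!(grid_sym AB0).
  exact: (proj2 (grid_chain hk A_chain B_chain AB0 (leqnn _)) x i iM).
split; first exact: trans eQ QQ.
split; first exact: trans eP PP.
by move=> x; rewrite elam elam1 elam2; have [_ oP _] := hP1; have [_ oQ _] := hQ2; rewrite oP oQ; apply: grid_sym.
Qed.
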